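(* Assume that $W$ is closed and bounded, that $\theta\mapsto\hat c_\theta(x)$ is differentiable for every $x\in\mathbb{R}^k$, and that there exists $B_L>0$ such that for all $\theta,\theta'\in\mathbb{R}^m$ and $x\in\mathbb{R}^k$, $\|\nabla_\theta\hat c_\theta(x)-\nabla_\theta\hat c_{\theta'}(x)\|\le B_L\|\theta-\theta'\|$. Let $\beta\in\mathbb{R}$ be such that $\overline W_{P_n}^\beta$ is nonempty. Then $\ell_{P_n}^\beta$ is a DC function, i.e. it is the difference of two convex functions $\mathbb{R}^m\to\mathbb{R}$.
   Context: $P_n$ is the uniform distribution over a dataset $(x_1,c_1),\dots,(x_n,c_n)\in\mathbb{R}^k\times\mathbb{R}^d$. $W\subset\mathbb{R}^d$ is a nonempty convex set, $\{\hat c_\theta:\theta\in\mathbb{R}^m\}$ is a parametric family of functions $\hat c_\theta:\mathbb{R}^k\to\mathbb{R}^d$, and $\|\cdot\|$ is the Euclidean norm (operator norm for matrices). $W_{P_n}$ is the set of mappings from $\{x_1,\dots,x_n\}$ to $W$, $\overline W_{P_n}^\beta=\{w\in W_{P_n}:\ \mathbb{E}_{(x,c)\sim P_n}(c^\top w(x))\le\beta\}$, and $$\ell_{P_n}^\beta(\theta)=\min_{\overline w\in\overline W_{P_n}^\beta}\mathbb{E}_{(x,c)\sim P_n}\big(\hat c_\theta(x)^\top\overline w(x)\big)-\min_{w\in W_{P_n}}\mathbb{E}_{(x,c)\sim P_n}\big(\hat c_\theta(x)^\top w(x)\big).$$ *)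

(* Defs.v *)
(* Points of R^p are row vectors. *)
From HB Require Import structures.
From mathcomp Require Import all_boot all_order all_algebra.
From mathcomp Require Import all_classical all_reals all_analysis.

Set Implicit Arguments.
Unset Strict Implicit.
Unset Printing Implicit Defensive.

Import Order.TTheory GRing.Theory Num.Theory.
Import numFieldNormedType.Exports.

Local Open Scope classical_set_scope.
Local Open Scope ring_scope.

Definition dot (R : realType) (p : nat) (u v : 'rV[R]_p) : R :=
  \sum_(j < p) u 0 j * v 0 j.

(* The library's norm [`|v|] on ['rV[R]_p] is the sup norm; it induces the same
   topology, bounded sets and differentials as the Euclidean norm. *)
Definition enorm (R : realType) (p : nat) (v : 'rV[R]_p) : R :=
  Num.sqrt (dot v v).

(* [A] acts on row vectors from the right, in agreement with the library's
   [jacobian], for which ['D_v f a = v *m jacobian f a]. *)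
Definition opnorm (R : realType) (p q : nat) (A : 'M[R]_(p, q)) : R :=
  sup [set enorm (v *m A) | v in [set v : 'rV[R]_p | enorm v <= 1]].

(* The least element of [A]; the default value 0 is returned only when [A] has
   no least element. *)
Definition min_of (R : realType) (A : set R) : R :=
  xget 0 (A `&` lbound A).

(* The index [i] seen as the element [xs i] of the set [{x_1, ..., x_n}], the
   latter being used as a type through the coercion [set_type]; repeated data
   points [xs i = xs j] give equal elements. *)
Definition datapt (R : realType) (k n : nat) (xs : 'I_n -> 'rV[R]_k)
    (i : 'I_n) : range xs :=
  SigSub (mem_set (imageT xs i)).

(* Expectation under the uniform distribution on the dataset
   [(xs i, cs i)_(i < n)], counted with multiplicity. *)
Definition expect (R : realType) (k d n : nat) (xs : 'I_n -> 'rV[R]_k)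
    (cs : 'I_n -> 'rV[R]_d) (g : range xs -> 'rV[R]_d -> R) : R :=
  n%:R^-1 * \sum_(i < n) g (datapt xs i) (cs i).
Arguments expect {R k d n} xs cs g.

Definition policies (R : realType) (k d n : nat) (xs : 'I_n -> 'rV[R]_k)
    (W : set 'rV[R]_d) : set (range xs -> 'rV[R]_d) :=
  [set w | forall x, W (w x)].
Arguments policies {R k d n} xs W _.

Definition policies_le (R : realType) (k d n : nat) (xs : 'I_n -> 'rV[R]_k)
    (cs : 'I_n -> 'rV[R]_d) (W : set 'rV[R]_d) (beta : R) :
    set (range xs -> 'rV[R]_d) :=
  [set w | policies xs W w /\ expect xs cs (fun x c => dot c (w x)) <= beta].
Arguments policies_le {R k d n} xs cs W beta _.

Definition loss (R : realType) (k d m n : nat) (xs : 'I_n -> 'rV[R]_k)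
    (cs : 'I_n -> 'rV[R]_d) (W : set 'rV[R]_d)
    (chat : 'rV[R]_m -> 'rV[R]_k -> 'rV[R]_d) (beta : R)
    (theta : 'rV[R]_m) : R :=
  let predicted_cost (w : range xs -> 'rV[R]_d) : R :=
    expect xs cs (fun x _ => dot (chat theta (val x)) (w x)) in
  min_of [set predicted_cost w | w in policies_le xs cs W beta]
  - min_of [set predicted_cost w | w in policies xs W].

Definition dc_function (R : realType) (m : nat) (f : 'rV[R]_m -> R) : Prop :=
  exists g h : 'rV[R]_m -> R,
    [/\ convex_function setT g, convex_function setT h
      & forall theta, f theta = g theta - h theta].

(* Main.v *)
Require Import Defs.
From HB Require Import structures.
From mathcomp Require Import all_boot all_order all_algebra.
From mathcomp Require Import all_classical all_reals all_analysis.
From mathcomp Require Import ring lra.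

Set Implicit Arguments.
Unset Strict Implicit.
Unset Printing Implicit Defensive.

Import Order.TTheory GRing.Theory Num.Theory.
Import numFieldNormedType.Exports.

Local Open Scope classical_set_scope.
Local Open Scope ring_scope.

(** Along a segment from [y] to [x], a function whose gradient is Lipschitz
    with constant [K] falls below its chord by at most
    [K / 2 * t * (1 - t) * |x - y|^2]; call such a function semiconcave with
    constant [C = K / 2]. For a fixed policy [w] with values in the bounded set
    [W], the predicted cost is an average of the functions
    [theta |-> dot (chat theta (xs i)) (w (xs i))], whose gradients are
    Lipschitz with a constant [BL * B] that depends on [w] only through a bound
    [B] for the norm on [W] ([lipschitz_jacobian_semiconcave]). So one constant
    [C] serves for all policies.

    The semiconcavity defect does not depend on the policy, hence a minimum over
    any set of policies is again semiconcave with the same [C]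
    ([semiconcave_min]), and [C * |theta|^2] minus this minimum is convex
    ([semiconcave_convex]). Both minima in the loss are of this kind, with the
    same [C], and the quadratic term cancels in
    [min1 - min2 = (C * |theta|^2 - min2) - (C * |theta|^2 - min1)].

    The minima have to be attained, because [min_of] returns a default value
    otherwise. The set of all policies is a power of the compact set [W], thus
    compact for the topology of pointwise convergence by Tychonoff's theorem;
    the budget constraint cuts out a closed part of it, and the predicted cost
    is continuous in the policy ([expect_dot_attains_min]). *)

(** * Euclidean inner product, norm and operator norm *)

Lemma continuous_sum (R : realType) (T : topologicalType) (n : nat)
    (f : 'I_n -> T -> R) :
  (forall i, continuous (f i)) -> continuous (fun x => \sum_i f i x).
Proof.
move=> f_cont; apply: (@continuous_big R _ +%R) => [|i _]; last exact: f_cont.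
exact: add_continuous.
Qed.

Section InnerProduct.
Variables (R : realType) (p : nat).
Implicit Types u v w : 'rV[R]_p.

Lemma dotDl u v w : dot (u + v) w = dot u w + dot v w.
Proof. by rewrite -big_split/=; apply: eq_bigr => j _; rewrite mxE mulrDl. Qed.

Lemma dotZl a u v : dot (a *: u) v = a * dot u v.
Proof. by rewrite mulr_sumr; apply: eq_bigr => j _; rewrite mxE mulrA. Qed.

Lemma dotC u v : dot u v = dot v u.
Proof. by apply: eq_bigr => j _; rewrite mulrC. Qed.

Lemma dotDr u v w : dot w (u + v) = dot w u + dot w v.
Proof. by rewrite dotC dotDl !(dotC w). Qed.

Lemma dotZr a u v : dot u (a *: v) = a * dot u v.
Proof. by rewrite dotC dotZl dotC. Qed.

Lemma dotBl u v w : dot (u - v) w = dot u w - dot v w.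
Proof. by rewrite dotDl -scaleN1r dotZl mulN1r. Qed.

Lemma dotBr u v w : dot w (u - v) = dot w u - dot w v.
Proof. by rewrite dotC dotBl !(dotC w). Qed.

Lemma dotvv_ge0 u : 0 <= dot u u.
Proof. by apply: sumr_ge0 => j _; rewrite -expr2 sqr_ge0. Qed.

Lemma dotvv_eq0 u : dot u u = 0 -> u = 0.
Proof.
move=> /eqP; rewrite psumr_eq0 => [|j _]; last by rewrite -expr2 sqr_ge0.
move=> /allP u0; apply/rowP => j; rewrite mxE; apply/eqP.
by have := u0 j (mem_index_enum j); rewrite mulf_eq0 orbb.
Qed.

(** Strong convexity of the squared norm in its exact form: this defect is what
    compensates the defect allowed in [semiconcave]. *)
Lemma dot_convex (t : R) u v :
  let z := t *: u + (1 - t) *: v in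
  dot z z = t * dot u u + (1 - t) * dot v v - t * (1 - t) * dot (u - v) (u - v).
Proof.
by rewrite /= !(dotBl, dotBr, dotDl, dotDr, dotZl, dotZr) (dotC v u); ring.
Qed.

Lemma enorm_ge0 u : 0 <= enorm u.
Proof. exact: sqrtr_ge0. Qed.

Lemma sqr_enorm u : enorm u ^+ 2 = dot u u.
Proof. by rewrite sqr_sqrtr// dotvv_ge0. Qed.

Lemma enormZ a u : enorm (a *: u) = `|a| * enorm u.
Proof.
by rewrite /enorm dotZl dotZr mulrA -expr2 sqrtrM ?sqr_ge0// sqrtr_sqr.
Qed.

Lemma enorm_eq0 u : enorm u = 0 -> u = 0.
Proof. by move=> u0; apply: dotvv_eq0; rewrite -sqr_enorm u0 expr0n. Qed.

(** Cauchy-Schwarz, from the nonnegativity of the squared norm of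
    [enorm v *: u - enorm u *: v]. *)
Lemma dot_le_enorm u v : dot u v <= enorm u * enorm v.
Proof.
have [u0|u_neq0] := eqVneq (enorm u) 0.
  rewrite u0 mul0r (enorm_eq0 u0) /dot big1// => j _.
  by rewrite mxE mul0r.
have [v0|v_neq0] := eqVneq (enorm v) 0.
  rewrite v0 mulr0 (enorm_eq0 v0) /dot big1// => j _.
  by rewrite mxE mulr0.
have uv_gt0 : 0 < enorm u * enorm v.
  by rewrite mulr_gt0 ?lt0r ?u_neq0 ?v_neq0 ?enorm_ge0.
have := dotvv_ge0 (enorm v *: u - enorm u *: v).
rewrite dotBl !dotBr !dotZl !dotZr -!sqr_enorm (dotC v u).
set a := enorm u in uv_gt0 *; set b := enorm v in uv_gt0 *.
have -> : b * (b * a ^+ 2) - b * (a * dot u v)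
          - (a * (b * dot u v) - a * (a * b ^+ 2))
  = (a * b * (a * b - dot u v)) *+ 2 by ring.
by rewrite pmulrn_lge0// pmulr_rge0// subr_ge0.
Qed.

Lemma coord_le_enorm u j : `|u 0 j| <= enorm u.
Proof.
rewrite -sqrtr_sqr; apply: ler_wsqrtr; rewrite /dot (bigD1 j)//= -expr2 lerDl.
by apply: sumr_ge0 => i _; rewrite -expr2 sqr_ge0.
Qed.

Lemma dot_continuous (u : 'rV[R]_p) : continuous (dot u).
Proof.
apply: continuous_sum => j v.
apply: continuousM; first exact: cst_continuous.
exact: (@coord_continuous R 1 p 0 j).
Qed.

End InnerProduct.

Lemma enorm_le (R : realType) (p : nat) (u : 'rV[R]_p) (b : 'I_p -> R) :
  (forall j, `|u 0 j| <= b j) -> enorm u <= Num.sqrt (\sum_j b j ^+ 2).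
Proof.
move=> ub; apply: ler_wsqrtr; apply: ler_sum => j _.
rewrite -expr2 -real_normK ?num_real// ler_sqr ?nnegrE//.
exact: le_trans (ub j).
Qed.

(** A supremum over an unbounded set is a default value, so the bound on the
    image of the unit ball has to be established before homogeneity is used. *)
Lemma enorm_mulmx_le (R : realType) (p q : nat) (A : 'M[R]_(p, q)) v :
  enorm (v *m A) <= opnorm A * enorm v.
Proof.
have unit_ball_bounded :
    has_ubound [set enorm (v *m A) | v in [set v : 'rV[R]_p | enorm v <= 1]].
  exists (Num.sqrt (\sum_j (\sum_i `|A i j|) ^+ 2)) => _ [u /= u1 <-].
  apply: enorm_le => j; rewrite mxE (le_trans (ler_norm_sum _ _ _))//.
  apply: ler_sum => i _; rewrite normrM ler_piMl//.
  exact: le_trans (coord_le_enorm u i) u1.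
have [v0|v_neq0] := eqVneq (enorm v) 0.
  by rewrite v0 mulr0 (enorm_eq0 v0) mul0mx -(scale0r 0) enormZ normr0 mul0r.
have v_gt0 : 0 < enorm v by rewrite lt0r v_neq0 enorm_ge0.
rewrite -ler_pdivrMr// mulrC.
apply: ub_le_sup => //=; exists ((enorm v)^-1 *: v).
  by rewrite /= enormZ ger0_norm ?invr_ge0 ?enorm_ge0// mulVf.
by rewrite -scalemxAl enormZ ger0_norm// invr_ge0 enorm_ge0.
Qed.

Lemma bounded_set_enorm (R : realType) (p : nat) (W : set 'rV[R]_p) :
  bounded_set W -> exists B, forall v, W v -> enorm v <= B.
Proof.
move=> /pinfty_ex_gt0[M M_gt0 WM].
exists (Num.sqrt (\sum_(j < p) M ^+ 2)) => v /WM vM; apply: enorm_le => j.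
apply: le_trans vM; rewrite [leRHS]/Num.norm/= mx_normrE.
exact: (le_bigmax _ (fun i : 'I_1 * 'I_p => `|v i.1 i.2|) (0, j)).
Qed.

(** * Semiconcave functions *)

(** Equivalently, [f] minus [C] times the squared norm is concave. The form with
    an explicit defect is kept because it is visibly stable under minima. *)
Definition semiconcave (R : realType) (m : nat) (C : R) (f : 'rV[R]_m -> R) :=
  forall (t : R) (x y : 'rV[R]_m), 0 <= t <= 1 ->
    t * f x + (1 - t) * f y - C * (t * (1 - t) * dot (x - y) (x - y))
    <= f (t *: x + (1 - t) *: y).

Section Semiconcave.
Variables (R : realType) (m : nat).
Implicit Types (C : R) (f : 'rV[R]_m -> R).

Lemma semiconcaveZ C a f :
  0 <= a -> semiconcave C f -> semiconcave (a * C) (fun x => a * f x).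
Proof.
move=> a0 fC t x y t01; apply: le_trans (ler_wpM2l a0 (fC t x y t01)).
by rewrite le_eqVlt; apply/orP; left; apply/eqP; ring.
Qed.

Lemma semiconcave_sum n (C : 'I_n -> R) (f : 'I_n -> 'rV[R]_m -> R) :
  (forall i, semiconcave (C i) (f i)) ->
  semiconcave (\sum_i C i) (fun x => \sum_i f i x).
Proof.
move=> fC t x y t01.
have := @ler_sum _ _ (index_enum 'I_n) xpredT _ _ (fun i _ => fC i t x y t01).
by rewrite sumrB big_split/= -!mulr_sumr -mulr_suml.
Qed.

Lemma semiconcave_convex C f : semiconcave C f ->
  convex_function setT (fun x => C * dot x x - f x).
Proof.
move=> fC t x y _ _.
have t01 : 0 <= (t%:num : R) <= 1 by rewrite ge0 le1.
pose s : R := t%:num; pose z : 'rV[R]_m := s *: x + (1 - s) *: y.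
change (C * dot z z - f z
        <= s * (C * dot x x - f x) + (1 - s) * (C * dot y y - f y)).
have := fC s x y t01; rewrite -/z /z dot_convex.
move: (f _) (f x) (f y) (dot x x) (dot y y) (dot _ _) => a b c p q r.
lra.
Qed.

End Semiconcave.

(** * Functions with Lipschitz derivative *)

(** Mean value theorem on [[0, t]] and on [[t, 1]]: the slope of the first chord
    is at most the slope of the second. *)
Lemma derive_nondecreasing_convex (R : realType) (f df : R -> R) (t : R) :
  (forall s : R, is_derive s 1 f (df s)) -> {homo df : r s / r <= s} ->
  0 <= t <= 1 -> f t <= t * f 1 + (1 - t) * f 0.
Proof.
move=> fdf df_mono /andP[t0 t1].
have f_cont : continuous f.
  by move=> s; apply/differentiable_continuous/derivable1_diffP.
have [|a /itvP a0t fa] := MVT_segment t0 (fun s _ => fdf s).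
  exact: continuous_subspaceT.
have [|b /itvP bt1 fb] := MVT_segment t1 (fun s _ => fdf s).
  exact: continuous_subspaceT.
have ab : df a <= df b.
  by apply: df_mono; rewrite (le_trans _ (_ : t <= b)) ?a0t ?bt1.
have : t * (1 - t) * df a <= t * (1 - t) * df b.
  by rewrite ler_wpM2l// mulr_ge0// subr_ge0.
have := congr1 ( *%R (1 - t)) fa; have := congr1 ( *%R t) fb.
lra.
Qed.

(** Adding [K / 2 * s ^+ 2] to [- f] makes its derivative nondecreasing. *)
Lemma derive_lipschitz_semiconcave (R : realType) (f df : R -> R) (K t : R) :
  (forall s : R, is_derive s 1 f (df s)) ->
  (forall r s, r <= s -> df s - df r <= K * (s - r)) ->
  0 <= t <= 1 -> t * f 1 + (1 - t) * f 0 - K / 2 * (t * (1 - t)) <= f t.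
Proof.
move=> fdf df_lip t01.
have := @derive_nondecreasing_convex _ (fun s => K / 2 * s ^+ 2 - f s)
  (fun s => K * s - df s) t.
move=> /(_ _ _ t01) H; suff : K / 2 * t ^+ 2 - f t <=
  t * (K / 2 * 1 ^+ 2 - f 1) + (1 - t) * (K / 2 * 0 ^+ 2 - f 0) by lra.
apply: H => [s|r s /df_lip].
  by apply: is_derive_eq; rewrite /GRing.scale/=; field.
by lra.
Qed.

Lemma is_derive_line (R : realType) (V W : normedModType R) (f : V -> W)
    (a h : V) (s : R) : derivable f (a + s *: h) h ->
  is_derive s 1 (fun r : R => f (a + r *: h)) ('D_h f (a + s *: h)).
Proof.
have E : (fun r : R => r^-1 *: (f (a + (r *: 1 + s) *: h) - f (a + s *: h)))
       = (fun r : R => r^-1 *: (f (r *: h + (a + s *: h)) - f (a + s *: h))).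
  apply/funext => r; congr (_ *: (f _ - _)).
  by rewrite -[r *: 1]/(r * 1) mulr1 scalerDl addrCA.
by move=> fh; split; rewrite /derivable /derive/= E.
Qed.

Lemma is_derive_dot (R : realType) (p : nat) (f : R -> 'rV[R]_p)
    (df v : 'rV[R]_p) (s : R) :
  is_derive s 1 f df -> is_derive s 1 (fun r => dot (f r) v) (dot df v).
Proof.
move=> [f_drv f_eq].
have -> : (fun r => dot (f r) v) = \sum_(j < p) (fun r => f r 0 j * v 0 j).
  by apply/funext => r; rewrite fct_sumE.
apply: is_derive_sum => j.
have fj : is_derive s 1 (fun r => f r 0 j) (df 0 j).
  split; first exact: (derivable_mxP _ _ _).1.
  by rewrite -f_eq derive_mx// mxE.
by apply: is_derive_eq; rewrite scaler0 add0r /GRing.scale/= mulrC.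
Qed.

(** The function restricted to the segment from [y] to [x] has derivative
    [dot (h *m J) v] with [h = x - y]; by Cauchy-Schwarz this derivative is
    Lipschitz in the parameter of the segment with constant [L * B * |h|^2]. *)
Lemma lipschitz_jacobian_semiconcave (R : realType) (m d : nat)
    (f : 'rV[R]_m -> 'rV[R]_d) (L B : R) (v : 'rV[R]_d) :
  (forall x, differentiable f x) ->
  (forall x y, opnorm (jacobian f x - jacobian f y) <= L * enorm (x - y)) ->
  enorm v <= B ->
  semiconcave (L * B / 2) (fun x => dot (f x) v).
Proof.
move=> f_diff f_lip vB t x y t01.
pose h := x - y.
have line_drv (s : R) : is_derive s 1 (fun r : R => dot (f (y + r *: h)) v)
    (dot (h *m jacobian f (y + s *: h)) v).
  apply: is_derive_dot; rewrite -deriveEjacobian//.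
  exact/is_derive_line/diff_derivable.
have := @derive_lipschitz_semiconcave _ _ _ (L * B * dot h h) t line_drv _ t01.
have -> : t *: x + (1 - t) *: y = y + t *: h.
  by rewrite scalerBr scalerBl scale1r addrCA.
rewrite scale1r scale0r addr0 [y + h]addrC subrK => H.
apply: le_trans (H _).
  by rewrite le_eqVlt; apply/orP; left; apply/eqP; ring.
move=> r s rs; rewrite -dotBl -mulmxBr.
apply: le_trans (dot_le_enorm _ _) _.
have hJ := enorm_mulmx_le (jacobian f (y + s *: h) - jacobian f (y + r *: h)) h.
have J_lip : opnorm (jacobian f (y + s *: h) - jacobian f (y + r *: h))
    <= L * ((s - r) * enorm h).
  apply: le_trans (f_lip _ _) _.
  by rewrite opprD addrACA subrr add0r -scalerBl enormZ ger0_norm// subr_ge0.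
have -> : L * B * dot h h * (s - r) = L * ((s - r) * enorm h) * enorm h * B.
  by rewrite -sqr_enorm; ring.
apply: ler_pM; rewrite ?enorm_ge0//.
by apply: le_trans hJ _; rewrite ler_wpM2r ?enorm_ge0.
Qed.

(** * Minima over sets of policies *)

Lemma min_of_image (R : realType) (T : Type) (F : T -> R) (A : set T) (w : T) :
  A w -> (forall w', A w' -> F w <= F w') -> min_of [set F w' | w' in A] = F w.
Proof.
move=> Aw wmin; apply: xget_unique.
  by split; [exists w|move=> _ [w' /wmin ? <-]].
move=> _ [[w' Aw' <-] lbw']; apply/le_anti/andP; split; last exact: wmin.
by apply: lbw'; exists w.
Qed.

(** A minimiser [w] at the convex combination is a competitor in the minima at
    both endpoints, so the inequality for [F ^~ w] gives the one for the minimum,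
    with the same defect. *)
Lemma semiconcave_min (R : realType) (m : nat) (T : Type) (C : R)
    (F : 'rV[R]_m -> T -> R) (A : set T) :
  (forall x, exists2 w, A w & forall w', A w' -> F x w <= F x w') ->
  (forall w, A w -> semiconcave C (F ^~ w)) ->
  semiconcave C (fun x => min_of [set F x w | w in A]).
Proof.
move=> Fmin FC t x y t01; have [t0 t1] := andP t01.
have [w Aw wmin] := Fmin (t *: x + (1 - t) *: y).
have [u Au umin] := Fmin x; have [v Av vmin] := Fmin y.
rewrite (min_of_image Aw wmin) (min_of_image Au umin) (min_of_image Av vmin).
apply: le_trans (FC w Aw t x y t01); rewrite lerB// lerD//.
  by rewrite ler_wpM2l// umin.
by rewrite ler_wpM2l ?subr_ge0// vmin.
Qed.

Section Policies.
Variables (R : realType) (k d n : nat).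
Variables (xs : 'I_n -> 'rV[R]_k) (cs : 'I_n -> 'rV[R]_d) (W : set 'rV[R]_d).

(** Pointwise convergence: the topology for which evaluation at a data point is
    continuous and Tychonoff's theorem applies. *)
Let policy_space : topologicalType :=
  prod_topology (fun _ : range xs => 'rV[R]_d : topologicalType).

Lemma expect_dot_continuous (q : range xs -> 'rV[R]_d -> 'rV[R]_d) :
  continuous (fun w : policy_space =>
    expect xs cs (fun x c => dot (q x c) (w x))).
Proof.
have sum_cont : continuous (fun w : policy_space =>
    \sum_(i < n) dot (q (datapt xs i) (cs i)) (w (datapt xs i))).
  apply: continuous_sum => i w; apply: continuous_comp.
    exact: proj_continuous.
  exact: dot_continuous.
move=> w; apply: (@continuousM R _ (cst n%:R^-1)); last exact: sum_cont.
exact: cst_continuous.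
Qed.

Lemma policies_compact :
  compact W -> compact (policies xs W : set policy_space).
Proof. by move=> Wc; exact: (@tychonoff _ _ (fun=> W)). Qed.

Lemma policies_le_compact beta : compact W ->
  compact (policies_le xs cs W beta : set policy_space).
Proof.
move=> /policies_compact Wc.
have -> : (policies_le xs cs W beta : set policy_space) = policies xs W `&`
    (fun w => expect xs cs (fun x c => dot c (w x))) @^-1` [set r | r <= beta].
  by [].
apply: compact_closedI => //.
apply: preimage_closed; last exact: closed_le.
by move=> w _; exact: expect_dot_continuous.
Qed.

Lemma expect_dot_attains_min (A : set (range xs -> 'rV[R]_d))
    (q : range xs -> 'rV[R]_d -> 'rV[R]_d) :
  A !=set0 -> compact (A : set policy_space) ->
  let F w := expect xs cs (fun x c => dot (q x c) (w x)) in
  exists2 w, A w & forall w', A w' -> F w <= F w'.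
Proof.
move=> A0 Ac F.
have [|w] := @compact_EVT_min policy_space R F A A0 Ac.
  exact/continuous_subspaceT/expect_dot_continuous.
rewrite inE => Aw wmin; exists w => // w' Aw'; apply: wmin.
by rewrite inE.
Qed.

End Policies.

Theorem proposition2 (R : realType) (k d m n : nat) (n_gt0 : (0 < n)%N)
    (xs : 'I_n -> 'rV[R]_k) (cs : 'I_n -> 'rV[R]_d)
    (W : set 'rV[R]_d) (W_nonempty : W !=set0) (W_convex : convex_set W)
    (W_closed : closed W) (W_bounded : bounded_set W)
    (chat : 'rV[R]_m -> 'rV[R]_k -> 'rV[R]_d)
    (chat_diff : forall (x : 'rV[R]_k) (theta : 'rV[R]_m),
       differentiable (fun t : 'rV[R]_m => chat t x) theta)
    (BL : R) (BL_gt0 : 0 < BL)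
    (chat_lip : forall (theta theta' : 'rV[R]_m) (x : 'rV[R]_k),
       opnorm (jacobian (fun t : 'rV[R]_m => chat t x) theta
               - jacobian (fun t : 'rV[R]_m => chat t x) theta')
       <= BL * enorm (theta - theta'))
    (beta : R) (beta_feasible : policies_le xs cs W beta !=set0) :
  dc_function (loss xs cs W chat beta).
Proof.
have W_compact := bounded_closed_compact W_bounded W_closed.
have [B W_B] := bounded_set_enorm W_bounded.
pose cost theta (w : range xs -> 'rV[R]_d) :=
  expect xs cs (fun x _ => dot (chat theta (val x)) (w x)).
(* Half the Lipschitz constant of the gradients, averaged over the data points
   as the cost is. *)
pose C := n%:R^-1 * \sum_(i < n) (BL * B / 2).
have cost_semiconcave w : policies xs W w -> semiconcave C (cost ^~ w).
  move=> wW; apply: semiconcaveZ; first by rewrite invr_ge0.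
  apply: semiconcave_sum => i.
  by apply: lipschitz_jacobian_semiconcave => //; exact/W_B/wW.
have min_semiconcave A : A `<=` policies xs W -> A !=set0 ->
    compact (A : set (prod_topology (fun _ : range xs => 'rV[R]_d))) ->
    semiconcave C (fun theta => min_of [set cost theta w | w in A]).
  move=> AW A0 Ac; apply: semiconcave_min => [theta|w /AW];
    last exact: cost_semiconcave.
  exact: (expect_dot_attains_min cs (fun x _ => chat theta (val x)) A0 Ac).
have le_policies : policies_le xs cs W beta `<=` policies xs W by move=> w [].
have all_convex := semiconcave_convex (min_semiconcave (policies xs W) _ _ _).
have le_convex := semiconcave_convex (min_semiconcave _ le_policies _ _).
exists (fun theta => C * dot theta theta
  - min_of [set cost theta w | w in policies xs W]).
exists (fun theta => C * dot theta theta
  - min_of [set cost theta w | w in policies_le xs cs W beta]).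
split=> [||theta].
- apply: all_convex => //; last exact: policies_compact.
  by case: beta_feasible => w /le_policies; exists w.
- by apply: le_convex => //; exact: policies_le_compact.
- by rewrite /loss -/(cost theta) opprB [RHS]addrC addrA subrK.
Qed.
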